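(* Let $\mathcal{A}\subset\mathbb{Z}$ be a finite alphabet, let $G=(V,E)$ be a finite directed graph with edge labelling $\ell:E\to\mathcal{A}$, assume the matrix $M=\sum_{a\in\mathcal{A}}M_a$ is primitive, and let $\beta>1$ be a Pisot number, with $\mathcal{K}^+,\mu^+,\phi^+$ as described in the context. Then the set $\phi^+(\mathcal{K}^+)\subseteq\mathbb{R}$ is either finite or perfect (and thus uncountable). In the first case the measure $(\phi^+)_*(\mu^+)$ is purely atomic; in the second case it is continuous (has no atoms).
   Context: For $a\in\mathcal{A}$, $M_a$ is the $V\times V$ matrix with $(M_a)_{ij}=1$ if $(i,j)\in E$ and $\ell((i,j))=a$, and $0$ otherwise. By Perron–Frobenius, $M$ has a dominant eigenvalue $\lambda>0$ with positive left eigenvector $\mathbf v_L$ and right eigenvector $\mathbf v_R$, normalised by $\mathbf v_L^{\mathsf T}\mathbf v_R=1$. $\mathcal{K}^+\subseteq\mathcal{A}^{\mathbb{N}}$ is the set of sequences $(\ell(e_k))_{k\ge1}$ for infinite paths $e_1e_2\ldots$ in $G$ (terminal vertex of $e_j$ equals initial vertex of $e_{j+1}$). $\mu^+$ is the Borel probability measure on $\mathcal{K}^+$ with $\mu^+([\varepsilon_1,\ldots,\varepsilon_k])=\lambda^{-k}\mathbf v_L^{\mathsf T}M_{\varepsilon_1}\cdots M_{\varepsilon_k}\mathbf v_R$ on cylinder sets $[\varepsilon_1,\ldots,\varepsilon_k]=\{x\in\mathcal{K}^+: x_1=\varepsilon_1,\ldots,x_k=\varepsilon_k\}$. A Pisot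 number is an algebraic integer $>1$ all of whose other Galois conjugates have modulus $<1$ (integers $\ge2$ included). $\phi^+:\mathcal{K}^+\to\mathbb{R}$, $(x_k)\mapsto\sum_{k\ge1}x_k\beta^{-k}$, and $(\phi^+)_*(\mu^+)(A)=\mu^+((\phi^+)^{-1}(A))$. *)

(* Defs.v *)
From HB Require Import structures.
From mathcomp Require Import all_boot all_order all_algebra.
From mathcomp Require Import all_classical all_reals all_analysis.
From mathcomp Require Import complex.

Set Implicit Arguments.
Unset Strict Implicit.
Unset Printing Implicit Defensive.

Import Order.TTheory GRing.Theory Num.Theory.
Import numFieldNormedType.Exports.
Local Open Scope classical_set_scope.
Local Open Scope ring_scope.

(* Pisot numbers: an algebraic integer beta > 1 all of whose other Galois   *)
(* conjugates have modulus < 1.  The minimal polynomial of an algebraic     *)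
(* integer is a monic irreducible (over Q) polynomial with integer          *)
(* coefficients; the Galois conjugates are its complex roots.               *)
Definition pisot (R : realType) (beta : R) : Prop :=
  1 < beta /\
  exists p : {poly int},
    [/\ p \is monic,
        irreducible_poly (map_poly (intr : int -> rat) p),
        root (map_poly (intr : int -> R) p) beta &
        forall z : R[i], root (map_poly (intr : int -> R[i]) p) z ->
          z != (beta%:C)%C -> `|z| < 1].

(* The labelled graph.  Vertices are 'I_n, edges are given by E : rel 'I_n  *)
(* ((i,j) is an edge iff E i j), the labelling by lab : 'I_n -> 'I_n -> int *)
(* (only its values on edges matter).                                       *)

Definition Mlab (R : realType) (n : nat) (E : rel 'I_n) (lab : 'I_n -> 'I_n -> int)
    (a : int) : 'M[R]_n :=
  \matrix_(i < n, j < n) (if E i j && (lab i j == a) then 1 else 0).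

Definition Mtot (R : realType) (n : nat) (E : rel 'I_n) (lab : 'I_n -> 'I_n -> int)
    (A : seq int) : 'M[R]_n :=
  \sum_(a <- A) Mlab R E lab a.

Definition primitive_mx (R : realType) (n : nat) (M : 'M[R]_n) : Prop :=
  (forall i j, 0 <= M i j) /\ exists k : nat, forall i j, 0 < (M ^+ k) i j.

Definition word_mx (R : realType) (n : nat) (E : rel 'I_n) (lab : 'I_n -> 'I_n -> int)
    (s : seq int) : 'M[R]_n :=
  foldr (fun a P => Mlab R E lab a *m P) 1%:M s.

Definition perron_data (R : realType) (n : nat) (M : 'M[R]_n) (lambda : R)
    (vL vR : 'cV[R]_n) : Prop :=
  [/\ 0 < lambda,
      forall z : R[i], root (map_poly (fun x : R => (x%:C)%C) (char_poly M)) z ->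
        `|z| <= (lambda%:C)%C,
      (vL^T *m M = lambda *: vL^T) /\ (M *m vR = lambda *: vR),
      (forall i, 0 < vL i 0) /\ (forall i, 0 < vR i 0) &
      (vL^T *m vR) 0 0 = 1].

(* Sequence space int^N (x_1 x_2 ... is represented by x 0, x 1, ...) with  *)
(* the sigma-algebra generated by the cylinder sets.                        *)
(* int as a pointed type (default point 0), needed for the measurable structure *)
HB.instance Definition _ := isPointed.Build int 0%R.

Definition cyl (s : seq int) : set (nat -> int) :=
  [set x | forall k, (k < size s)%N -> x k = nth 0 s k].

Definition cylinders : set (set (nat -> int)) := [set C | exists s, C = cyl s].

Definition seqspace := g_sigma_algebraType cylinders.

Definition Kplus (n : nat) (E : rel 'I_n) (lab : 'I_n -> 'I_n -> int) :
    set (nat -> int) :=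
  [set x | exists v : nat -> 'I_n,
     forall k, E (v k) (v k.+1) /\ x k = lab (v k) (v k.+1)].

Definition phiplus (R : realType) (beta : R) (x : nat -> int) : R :=
  limn (series (fun k : nat => (x k)%:~R * beta ^- k.+1)).

(* the push-forward (phi^+)_* (mu^+) : B |-> mu^+ ((phi^+)^{-1}(B)),
   the preimage being taken inside K^+ (the domain of phi^+) *)
Definition pushmu (R : realType) (n : nat) (E : rel 'I_n) (lab : 'I_n -> 'I_n -> int)
    (beta : R) (mu : set seqspace -> \bar R) : set R -> \bar R :=
  fun B => mu (Kplus E lab `&` (phiplus beta) @^-1` B).

(* purely atomic probability measure: concentrated on a countable set *)
Definition purely_atomic (R : realType) (nu : set R -> \bar R) : Prop :=
  exists S : set R, countable S /\ nu S = 1%E.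

Definition no_atoms (R : realType) (nu : set R -> \bar R) : Prop :=
  forall y : R, nu [set y] = 0%E.

(* Main.v *)
Require Import Defs.
From HB Require Import structures.
From mathcomp Require Import all_boot all_order all_algebra.
From mathcomp Require Import all_classical all_reals all_analysis.
From mathcomp Require Import complex.
From mathcomp Require Import ring.
Import Order.TTheory GRing.Theory Num.Theory.
Import numFieldNormedType.Exports.
Local Open Scope classical_set_scope.
Local Open Scope ring_scope.

(* Let Phi_i be the set of values of the paths starting at the vertex i, and
   f_ij y = beta y - lab i j.  Then y is in Phi_i iff f_ij y is in Phi_j for
   some edge (i, j), so Phi_i is the set of starting points of bounded orbits
   of the f_ij, and it is closed by Koenig's lemma.  A small neighbourhood of a
   point of Phi_i contains a scaled copy of some Phi_j; hence an isolated point
   makes some Phi_j a singleton, and then, by irreducibility, all of them, so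
   that Phi is finite.

   For the atoms, mu is the image of a stationary Markov chain with transition
   probabilities p_ij = vR_j / (lambda vR_i).  The mass m_i y that the chain
   started at i gives to y satisfies m_i y = sum_j p_ij m_j (f_ij y).  If it is
   not identically 0 it attains its maximum, say at (i, y), and the maximum is
   then inherited by (j, f_ij y) for every edge (i, j).  Thus the orbit of y
   along every path from i stays bounded, and Phi_i = {y}: Phi is finite. *)

Set Implicit Arguments.
Unset Strict Implicit.
Unset Printing Implicit Defensive.

(** * Koenig's lemma for finitely branching systems *)

Lemma pigeonhole_antitone (I : finType) (P : nat -> I -> Prop) :
  (forall k l j, (k <= l)%N -> P l j -> P k j) ->
  (forall k, exists j, P k j) -> exists j, forall k, P k j.
Proof.
move=> anti exP; apply: contrapT => none.
have fails j : exists k, ~ P k j.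
  by apply: contrapT => /forallNP nk; apply: none; exists j => k;
    exact: contrapT.
have [d dP] := choice fails.
(* At the largest of the failing levels [d j], antitonicity makes every [j] fail. *)
have [j Pj] := exP (\max_j d j).
by apply: (dP j); apply: anti Pj; exact: leq_bigmax.
Qed.

Section Koenig.
Variables (T : Type) (I : finType) (step : T -> I -> T).
Variables (edge : T -> I -> Prop) (ok : T -> Prop).

Fixpoint survives (k : nat) (t : T) : Prop :=
  if k is k'.+1 then ok t /\ exists2 j, edge t j & survives k' (step t j)
  else ok t.

Lemma survivesS k t : survives k.+1 t -> survives k t.
Proof.
elim: k t => [|k IHk] t [okt [j ej sj]]; first by [].
by split=> //; exists j => //; exact: IHk.
Qed.

Lemma survives_le k l t : (k <= l)%N -> survives l t -> survives k t.
Proof.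
elim: l => [|l IHl]; first by rewrite leqn0 => /eqP ->.
rewrite leq_eqVlt => /orP[/eqP -> //|lt_kl] /survivesS.
exact: IHl.
Qed.

(** The choices [j] are finite in number and survival is antitone in the length, so one choice works
    for all lengths at once. *)
Lemma survives_step t : (forall k, survives k t) ->
  exists2 j, edge t j & forall k, survives k (step t j).
Proof.
move=> st.
have [|k|j ej] := @pigeonhole_antitone I
    (fun k j => edge t j /\ survives k (step t j)).
- by move=> k l j le_kl [ej /(survives_le le_kl)].
- by have [_ [j ej sj]] := st k.+1; exists j.
by exists j => [|k]; [have [] := ej 0%N|have [] := ej k].
Qed.

Lemma koenig t : (forall k, survives k t) ->
  exists s : nat -> T, exists c : nat -> I,
    [/\ s 0%N = t, forall k, s k.+1 = step (s k) (c k),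
        forall k, edge (s k) (c k) & forall k, ok (s k)].
Proof.
move=> st.
have next (u : {u | forall k, survives k u}) :
    exists j, edge (sval u) j /\ forall k, survives k (step (sval u) j).
  by have [j] := survives_step (svalP u); exists j.
have [c cP] := choice next.
pose nxt u : {u | forall k, survives k u} := exist _ _ (cP u).2.
pose s k := iter k nxt (exist _ t st).
exists (fun k => sval (s k)), (fun k => c (s k)); split=> //.
- by move=> k; case: (cP (s k)).
- by move=> k; exact: (svalP (s k) 0%N).
Qed.

End Koenig.

(** * Expansions in base [beta] with bounded integer digits *)

Lemma series_shift (F : fieldType) (b : F) (a : nat -> F) (k : nat) : b != 0 ->
  series (fun k => a k.+1 * b ^- k.+1) k =
  b * series (fun k => a k * b ^- k.+1) k.+1 - a 0%N.
Proof.
move=> b0; rewrite /series /= big_nat_recl//= expr1 mulrDr mulrCA divff// mulr1.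
rewrite addrAC subrr add0r mulr_sumr; apply: eq_bigr => i _.
by rewrite mulrCA [in RHS]exprS invfM mulVKf.
Qed.

Section BetaExpansion.
Variables (R : realType) (beta : R).
Hypothesis beta_gt1 : 1 < beta.

Let beta_gt0 : 0 < beta. Proof. exact: lt_trans ltr01 beta_gt1. Qed.

Definition seq_tail (x : nat -> int) : nat -> int := fun k => x k.+1.

Definition digit_bounded (B : R) (x : nat -> int) :=
  forall k, `|(x k)%:~R| <= B.

Let inv_beta_lt1 : `|beta^-1| < 1.
Proof. by rewrite ger0_norm ?invf_lt1// invr_ge0 ltW. Qed.

Lemma geometric_small (D e : R) : 0 < e -> exists k, D * beta ^- k < e.
Proof.
move=> e0.
have /cvgrPdist_lt/(_ (e / (`|D| + 1))) := cvg_expr inv_beta_lt1.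
rewrite divr_gt0 ?ltr_wpDl// => /(_ isT)[k _ /(_ k (leqnn k))] /=.
rewrite sub0r normrN exprVn ger0_norm ?invr_ge0 ?exprn_ge0 ?(ltW beta_gt0)//.
rewrite ltr_pdivlMr ?ltr_wpDl// => Hk; exists k; apply: le_lt_trans Hk.
rewrite mulrC; apply: ler_wpM2l; first by rewrite invr_ge0 exprn_ge0 // ltW.
by rewrite (le_trans (ler_norm D))// lerDl.
Qed.

Variable B : R.

Lemma is_cvg_phiplus x : digit_bounded B x ->
  cvgn (series (fun k : nat => (x k)%:~R * beta ^- k.+1 : R)).
Proof.
move=> Bx; apply: normed_cvg.
apply: (@series_le_cvg _ _ (geometric (B * beta^-1) beta^-1)) => [k|k|k|].
- exact: normr_ge0.
- rewrite /= !mulr_ge0 ?exprn_ge0 ?invr_ge0 ?(ltW beta_gt0)//.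
  exact: le_trans (normr_ge0 _) (Bx 0%N).
- rewrite /= normrM -mulrA -exprS exprVn.
  rewrite [`|_ ^-1|]ger0_norm ?invr_ge0 ?exprn_ge0 ?(ltW beta_gt0)//.
  by rewrite ler_wpM2r ?invr_ge0 ?exprn_ge0 ?(ltW beta_gt0)//.
- exact: is_cvg_geometric_series.
Qed.

Lemma phiplus_tail x : digit_bounded B x ->
  phiplus beta (seq_tail x) = beta * phiplus beta x - (x 0%N)%:~R.
Proof.
move=> Bx; have cx := is_cvg_phiplus Bx.
apply: cvg_lim => //=.
rewrite (_ : series _ = fun k => beta *
    series (fun k : nat => (x k)%:~R * beta ^- k.+1) k.+1 - (x 0%N)%:~R).
  apply: cvgB; last exact: cvg_cst.
  by apply: cvgMr; rewrite cvg_shiftS.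
apply/funext => k.
by have := series_shift (fun k => (x k)%:~R) k (lt0r_neq0 beta_gt0).
Qed.

(** The sum of [B * beta ^- k] over k >= 1, and also the fixed point of [c |-> (c + B) / beta]. *)
Definition expansion_radius : R := B / (beta - 1).

Lemma phiplus_bound x : digit_bounded B x ->
  `|phiplus beta x| <= expansion_radius.
Proof.
move=> Bx; have cx := is_cvg_phiplus Bx.
have b1 : 0 < beta - 1 by rewrite subr_gt0.
have B0 : 0 <= B := le_trans (normr_ge0 _) (Bx 0%N).
(* The right-hand side is the sum of [B * beta ^- j] over 1 <= j <= k. *)
have psum k : `|series (fun k : nat => (x k)%:~R * beta ^- k.+1 : R) k|
    <= expansion_radius * (1 - beta ^- k).
  elim: k => [|k IHk]; first
    by rewrite /series/= big_geq// normr0 expr0 invr1 subrr mulr0.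
  rewrite /series /= big_nat_recr//=.
  have -> : expansion_radius * (1 - beta ^- k.+1) =
      expansion_radius * (1 - beta ^- k) + B * beta ^- k.+1.
    rewrite /expansion_radius exprS invfM; field.
    by rewrite expf_neq0 ?gt_eqF.
  rewrite (le_trans (ler_normD _ _))// lerD// normrM.
  rewrite [`|_ ^-1|]ger0_norm ?invr_ge0 ?exprn_ge0 ?(ltW beta_gt0)//.
  by rewrite ler_wpM2r ?invr_ge0 ?exprn_ge0 ?(ltW beta_gt0)//.
have /= <- := lim_norm cx; apply: limr_le; first exact: is_cvg_norm.
apply: nearW => k; apply: le_trans (psum k) _.
by rewrite ler_piMr ?divr_ge0 ?(ltW b1)// gerDl oppr_le0 invr_ge0 exprn_ge0//
  ltW.
Qed.

End BetaExpansion.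

(** * Value sets of paths from a vertex: closedness and isolated points *)

Section GraphDirectedSet.
Variables (R : realType) (n : nat) (E : rel 'I_n) (lab : 'I_n -> 'I_n -> int).
Variables (beta B : R).
Hypothesis beta_gt1 : 1 < beta.
Hypothesis lab_bounded : forall i j, E i j -> `|(lab i j)%:~R| <= B.

Let beta_gt0 : 0 < beta. Proof. exact: lt_trans ltr01 beta_gt1. Qed.

Definition Kfrom (i : 'I_n) : set (nat -> int) :=
  [set x | exists v : nat -> 'I_n, v 0%N = i /\
     forall k, E (v k) (v k.+1) /\ x k = lab (v k) (v k.+1)].

Lemma KplusE : Kplus E lab = \bigcup_i Kfrom i.
Proof.
apply/seteqP; split=> [x [v vP]|x [i _ [v [_ vP]]]]; last by exists v.
by exists (v 0%N) => //; exists v.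
Qed.

Lemma Kfrom_bounded i x : Kfrom i x -> digit_bounded B x.
Proof. by move=> [v [_ vP]] k; have [Ek ->] := vP k; exact: lab_bounded. Qed.

Lemma Kfrom_tail i x : Kfrom i x ->
  exists j, [/\ E i j, x 0%N = lab i j & Kfrom j (seq_tail x)].
Proof.
move=> [v [<- vP]]; exists (v 1%N); have [E0 x0] := vP 0%N; split=> //.
by exists (fun k => v k.+1); split=> // k; exact: vP.
Qed.

Lemma Kfrom_cons i j x : E i j -> Kfrom j x ->
  Kfrom i (fun k => if k is k'.+1 then x k' else lab i j).
Proof.
move=> Eij [v [v0 vP]].
exists (fun k => if k is k'.+1 then v k' else i); split=> // -[|k].
  by rewrite v0.
exact: vP.
Qed.

Definition Phifrom (i : 'I_n) : set R := phiplus beta @` Kfrom i.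

Definition orbit_map (i j : 'I_n) (y : R) : R := beta * y - (lab i j)%:~R.

Lemma orbit_mapB i j y z : orbit_map i j y - orbit_map i j z = beta * (y - z).
Proof. by rewrite /orbit_map; ring. Qed.

Let C := expansion_radius beta B.

(** Since [beta * C = C + B], the inverse of [orbit_map i j] maps [-C, C] into itself; an orbit that
    leaves this interval never returns. *)
Lemma radius_contract i j y : E i j -> `|orbit_map i j y| <= C -> `|y| <= C.
Proof.
move=> Eij le_C; have b1 : 0 < beta - 1 by rewrite subr_gt0.
rewrite -(ler_pM2l beta_gt0) -{1}(gtr0_norm beta_gt0) -normrM.
have -> : beta * C = C + B.
  by rewrite /C /expansion_radius; field; rewrite gt_eqF.
have -> : beta * y = orbit_map i j y + (lab i j)%:~R.
  by rewrite /orbit_map subrK.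
by rewrite (le_trans (ler_normD _ _))// lerD// lab_bounded.
Qed.

Lemma Phifrom_bound i y : Phifrom i y -> `|y| <= C.
Proof. by move=> [x /Kfrom_bounded Bx <-]; exact: phiplus_bound. Qed.

Lemma Phifrom_expand i y : Phifrom i y ->
  exists2 j, E i j & Phifrom j (orbit_map i j y).
Proof.
move=> [x Kx <-]; have [j [Eij x0 Kj]] := Kfrom_tail Kx; exists j => //.
exists (seq_tail x) => //.
by rewrite (phiplus_tail beta_gt1 (Kfrom_bounded Kx)) x0.
Qed.

Lemma Phifrom_cons i j z : E i j -> Phifrom j z ->
  Phifrom i ((z + (lab i j)%:~R) / beta).
Proof.
move=> Eij [x Kx <-]; have Kc := Kfrom_cons Eij Kx; eexists; first exact: Kc.
have := phiplus_tail beta_gt1 (Kfrom_bounded Kc); rewrite /seq_tail /= => ->.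
by rewrite subrK mulrC mulKf ?gt_eqF.
Qed.

(** Each step multiplies the distance from [y k] to the value of the k-th tail of [x] by [beta], yet
    this distance stays at most [C + C]. The initial distance is thus at most [(C + C) * beta ^- k]
    for every [k]. *)
Lemma expansion_unique (y : nat -> R) x : digit_bounded B x ->
    (forall k, y k.+1 = beta * y k - (x k)%:~R) -> (forall k, `|y k| <= C) ->
  y 0%N = phiplus beta x.
Proof.
move=> Bx yS yC; apply/eqP; rewrite -subr_eq0 -normr_le0 leNgt; apply/negP.
move=> /(geometric_small beta_gt1 (C + C))[k]; apply/negP; rewrite -leNgt.
elim: k y x Bx yS yC => [|k IHk] y x Bx yS yC.
  rewrite expr0 invr1 mulr1 (le_trans (ler_normB _ _))// lerD//.
  exact: phiplus_bound.
have := IHk (fun k => y k.+1) (seq_tail x) (fun k => Bx k.+1)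
  (fun k => yS k.+1) (fun k => yC k.+1).
rewrite yS (phiplus_tail beta_gt1 Bx).
rewrite [X in `|X|](_ : _ = beta * (y 0%N - phiplus beta x)); last by ring.
rewrite normrM (gtr0_norm beta_gt0) -ler_pdivlMl// => IH.
by rewrite (le_trans IH)// exprS invfM mulrCA.
Qed.

Let step (t : 'I_n * R) (j : 'I_n) : 'I_n * R := (j, orbit_map t.1 j t.2).
Let edge (t : 'I_n * R) (j : 'I_n) : Prop := E t.1 j.
Let ok (t : 'I_n * R) : Prop := `|t.2| <= C.

Lemma Phifrom_survives i y :
  Phifrom i y <-> forall k, survives step edge ok k (i, y).
Proof.
split=> [Phi_y k|surv].
  elim: k i y Phi_y => [|k IHk] i y Phi_y; first exact: Phifrom_bound Phi_y.
  split; first exact: Phifrom_bound Phi_y.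
  by have [j Eij Phi_j] := Phifrom_expand Phi_y; exists j => //; exact: IHk.
have [s [c [s0 sS sE sC]]] := koenig surv.
(* The digits are the labels along the infinite path given by Koenig's lemma; the orbit [(s k).2]
   stays bounded, so [y] is their value. *)
pose x k := lab (s k).1 (s k.+1).1.
have E_s k : E (s k).1 (s k.+1).1 by rewrite [in (s k.+1).1]sS; exact: sE.
have Kx : Kfrom i x by exists (fun k => (s k).1); rewrite s0; split.
exists x => //; rewrite -[y]/((i, y).2) -s0.
apply/esym/(@expansion_unique (fun k => (s k).2)) => [|k|//].
  exact: Kfrom_bounded Kx.
by rewrite /x sS.
Qed.

(** One more step intersects [-C, C] with a finite union, over the outgoing edges, of preimages of
    closed sets under continuous maps. *)
Lemma closed_survives k i : closed [set y | survives step edge ok k (i, y)].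
Proof.
have closed_ok : closed [set y : R | `|y| <= C].
  rewrite (_ : mkset _ = (fun y : R => `|y|) @^-1` [set x | x <= C])//.
  by apply: preimage_closed => [y _|];
    [exact: norm_continuous|exact: closed_le].
elim: k i => [|k IHk] i //=.
rewrite [X in closed X](_ : _ = [set y | `|y| <= C] `&`
    \bigcup_(j in [set j | E i j])
      orbit_map i j @^-1` [set y | survives step edge ok k (j, y)]).
  apply: closedI => //.
  apply: closed_bigcup => [|j _]; first exact: finite_finset.
  apply: preimage_closed => [y _|]; last exact: IHk.
  by apply: cvgB; [apply: cvgMr; exact: cvg_id|exact: cvg_cst].
by apply/seteqP; split=> y /= [okt [j]]; split=> //; exists j.
Qed.

Lemma closed_Phifrom i : closed (Phifrom i).
Proof.
rewrite (_ : Phifrom i = \bigcap_k [set y | survives step edge ok k (i, y)]).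
  by apply: closed_bigI => k _; exact: closed_survives.
apply/seteqP; split=> y; first by move/Phifrom_survives => s k _; exact: s.
by move=> s; apply/Phifrom_survives => k; exact: s.
Qed.

(** Prefixing the edge embeds [Phifrom j] into [Phifrom i] by an injective affine map. *)
Lemma is_subset1_Phifrom_edge i j : E i j ->
  is_subset1 (Phifrom i) -> is_subset1 (Phifrom j).
Proof.
move=> Eij sub1 y z /(Phifrom_cons Eij) + /(Phifrom_cons Eij).
by move=> /sub1 /[apply] /divIf /addIr; apply; rewrite gt_eqF.
Qed.

(** [y'] is the k-th point of an orbit of [y]; prefixing the same [k] edges to the other paths from
    [j] produces a copy scaled by [beta ^- k]. *)
Lemma Phifrom_rescale k i y : Phifrom i y -> exists j y',
  Phifrom j y' /\ forall z, Phifrom j z -> Phifrom i (y + beta ^- k * (z - y')).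
Proof.
elim: k i y => [|k IHk] i y Phi_y.
  by exists i, y; split=> // z; rewrite expr0 invr1 mul1r addrC subrK.
have [j Eij /IHk[l [y' [Phi_y' zoom]]]] := Phifrom_expand Phi_y.
exists l, y'; split=> // z /zoom /(Phifrom_cons Eij).
congr Phifrom; rewrite /orbit_map exprS; field.
by rewrite expf_neq0 gt_eqF.
Qed.

(** [Phi] will be the union of all value sets: isolation is assumed there, while the scaled copy
    lies in the piece [Phifrom i]. *)
Lemma isolated_is_subset1 i y (Phi : set R) : Phifrom i `<=` Phi ->
  Phifrom i y -> ~ limit_point Phi y -> exists j, is_subset1 (Phifrom j).
Proof.
move=> sub Phi_y isolated.
have [U] : exists U : set R, nbhs y U /\
    ~ exists z, [/\ z != y, Phi z & U z].
  apply: contrapT => /forallNP nU; apply: isolated => U Uy.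
  by apply: contrapT => nz; apply: (nU U).
move=> [/nbhs_ballP[e /= e0 eU] iso].
(* Two points of a value set are at most [C + C] apart, so this [k] puts the whole scaled copy into
   the ball of radius [e] around [y]. *)
have [k kP] := geometric_small beta_gt1 (C + C) e0.
have [j [y' [Phi_y' zoom]]] := Phifrom_rescale k Phi_y.
exists j; suff eq_y' z : Phifrom j z -> z = y'.
  by move=> u v /eq_y' -> /eq_y' ->.
move=> Phi_z; have /sub Phi_w := zoom _ Phi_z.
apply: contrapT => /eqP z_neq; apply: iso; eexists; split; [|exact: Phi_w|].
  by rewrite -subr_eq0 addrC addKr mulf_neq0 ?subr_eq0// invr_neq0//
    expf_neq0// gt_eqF.
apply: eU; rewrite -ball_normE /= opprD addNKr normrN normrM.
apply: le_lt_trans kP; rewrite mulrC.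
rewrite [`|_^-1|]ger0_norm ?invr_ge0 ?exprn_ge0 ?(ltW beta_gt0)//.
rewrite ler_wpM2r ?invr_ge0 ?exprn_ge0 ?(ltW beta_gt0)//.
by rewrite (le_trans (ler_normB _ _))// lerD// (@Phifrom_bound j).
Qed.

Lemma finite_Phi : (forall i, is_subset1 (Phifrom i)) ->
  finite_set (\bigcup_i Phifrom i).
Proof.
move=> sub1; apply: bigcup_finite => [|i _]; first exact: finite_finset.
have [->|/set0P[y Phi_y]] := eqVneq (Phifrom i) set0; first exact: finite_set0.
apply: (sub_finite_set _ (finite_set1 y)) => z Phi_z.
exact: sub1 Phi_z Phi_y.
Qed.

End GraphDirectedSet.

(** * Maxima and separation in finite lists *)

Lemma seq_argmax d (T : orderType d) (S : eqType) (f : S -> T) (s : seq S) :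
  s != [::] -> exists2 x, x \in s & forall y, y \in s -> (f y <= f x)%O.
Proof.
elim: s => // x [_ _|z s IHs _].
  by exists x => [|y]; rewrite inE// => /eqP ->.
have [//|w ws w_max] := IHs; have [xw|/ltW wx] := leP (f x) (f w).
  exists w => [|y]; first by rewrite inE ws orbT.
  by rewrite inE => /orP[/eqP ->|/w_max].
exists x => [|y]; first exact: mem_head.
by rewrite inE => /orP[/eqP -> //|/w_max/le_trans]; exact.
Qed.

Lemma uniq_separated (R : realType) (s : seq R) : uniq s ->
  exists2 e, 0 < e & pairwise (fun y z => e <= `|y - z|) s.
Proof.
elim: s => [_|y s IHs /= /andP[y_s /IHs[e e0 sep]]]; first by exists 1.
suff [e1 e1_gt0 sep1] : exists2 e, 0 < e & all (fun z => e <= `|y - z|) s.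
  exists (Num.min e e1); first by rewrite lt_min e0.
  apply/andP; split.
    by apply: sub_all sep1 => z; apply: le_trans; rewrite ge_min lexx orbT.
  by apply: sub_pairwise sep => u v; apply: le_trans; rewrite ge_min lexx.
elim: s y_s {IHs sep} => [_|z s IHs]; first by exists 1.
rewrite inE negb_or => /andP[y_z /IHs[d d0 sep]].
exists (Num.min d `|y - z|); first by rewrite lt_min d0 normr_gt0 subr_eq0.
rewrite /= ge_min lexx orbT /=.
by apply: sub_all sep => u; apply: le_trans; rewrite ge_min lexx.
Qed.

(** * Point masses of the Markov chain *)

Section AtomMass.
Variables (R : realType) (n : nat) (E : rel 'I_n) (lab : 'I_n -> 'I_n -> int).
Variables (beta B : R) (p : 'I_n -> 'I_n -> R).
Hypothesis beta_gt1 : 1 < beta.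
Hypothesis lab_bounded : forall i j, E i j -> `|(lab i j)%:~R| <= B.
Hypothesis p_gt0 : forall i j, E i j -> 0 < p i j.
Hypothesis p_eq0 : forall i j, ~~ E i j -> p i j = 0.
Hypothesis p_sum1 : forall i, \sum_j p i j = 1.

Let beta_gt0 : 0 < beta. Proof. exact: lt_trans ltr01 beta_gt1. Qed.
Let C := expansion_radius beta B.
Local Notation orbit_map := (orbit_map lab beta).

Let p_ge0 i j : 0 <= p i j.
Proof. by have [/p_gt0/ltW|/p_eq0 ->] := boolP (E i j). Qed.

(* The probability that the Markov chain p started at i reads k digits that
   can still be continued to an expansion of y. *)
Fixpoint mass_approx (k : nat) (i : 'I_n) (y : R) : R :=
  if k is k'.+1 then \sum_j p i j * mass_approx k' j (orbit_map i j y)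
  else ((`|y| <= C)%R)%:R.

Lemma mass_approx_ge0 k i y : 0 <= mass_approx k i y.
Proof.
elim: k i y => [|k IHk] i y //=.
by apply: sumr_ge0 => j _; rewrite mulr_ge0.
Qed.

(** The base case holds because every edge sends a point outside [-C, C] outside again; averaging
    preserves the inequality. *)
Lemma mass_approxS k i y : mass_approx k.+1 i y <= mass_approx k i y.
Proof.
elim: k i y => [|k IHk] i y; last first.
  by apply: ler_sum => j _; apply: ler_wpM2l; [exact: p_ge0|exact: IHk].
rewrite /=; have [yC|y_gtC] := boolP (`|y| <= C).
  apply: le_trans (_ : _ <= \sum_j p i j) _; last by rewrite p_sum1.
  apply: ler_sum => j _; rewrite ler_piMr//.
  by case: (`|_| <= _); rewrite ?ler01 ?lexx.
rewrite big1// => j _; have [Eij|/p_eq0 ->] := boolP (E i j); last exact: mul0r.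
by rewrite (contraNF (radius_contract beta_gt1 lab_bounded Eij) y_gtC) mulr0.
Qed.

Let mass_approx_noninc i y :
  {homo mass_approx^~ i^~ y : k l / (k <= l)%N >-> l <= k}.
Proof. by apply/nonincreasing_seqP => k; exact: mass_approxS. Qed.

Let is_cvg_mass_approx i y : cvgn (fun k => mass_approx k i y).
Proof.
apply: nonincreasing_is_cvgn; first exact: mass_approx_noninc.
by exists 0 => _ [k _ <-]; exact: mass_approx_ge0.
Qed.

(** A path has value [y] exactly when the orbit of [y] along it never leaves [-C, C], so this limit
    is the mass [m_i y]. *)
Definition mass (i : 'I_n) (y : R) : R := limn (fun k => mass_approx k i y).

Lemma cvg_mass i y : mass_approx k i y @[k --> \oo] --> mass i y.
Proof. exact: is_cvg_mass_approx. Qed.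

Lemma mass_le_approx k i y : mass i y <= mass_approx k i y.
Proof. exact: nonincreasing_cvgn_ge (@mass_approx_noninc i y) _ k. Qed.

Lemma mass_ge0 i y : 0 <= mass i y.
Proof. by apply: limr_ge => //; apply: nearW => k; exact: mass_approx_ge0. Qed.

Lemma mass_expand i y : mass i y = \sum_j p i j * mass j (orbit_map i j y).
Proof.
apply: cvg_lim => //; rewrite -cvg_shiftS /=.
apply: cvg_big => [|j _]; first exact: add_continuous.
by apply: cvgMr; exact: cvg_mass.
Qed.

Lemma mass_bound i y : 0 < mass i y -> `|y| <= C.
Proof.
move=> y0; have /= := lt_le_trans y0 (mass_le_approx 0 i y).
by case: (_ <= _) => //; rewrite ltxx.
Qed.

(** Along [k] edges distances grow by [beta ^+ k], so at most one point of [s] can end in [-C, C]: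
    the events whose probabilities are added are disjoint. *)
Lemma sum_mass_approx_le1 k i s :
  pairwise (fun y z => C + C < beta ^+ k * `|y - z|) s ->
  \sum_(y <- s) mass_approx k i y <= 1.
Proof.
elim: k i s => [|k IHk] i s sep.
  elim: s sep => [_|y s IHs /= /andP[sep_y /IHs le1]]; first by rewrite big_nil.
  rewrite big_cons; have [yC|_] := boolP (`|y| <= C); last by rewrite /= add0r.
  rewrite big_seq big1 ?addr0// => z /(allP sep_y); rewrite expr0 mul1r.
  move=> lt_sep /=; case: (leP _ C) => // zC.
  move: lt_sep; rewrite ltNge (le_trans (ler_normB _ _))//.
  exact: lerD.
rewrite exchange_big; apply: le_trans (_ : _ <= \sum_j p i j) _; last first.
  by rewrite p_sum1.
apply: ler_sum => j _.
rewrite -mulr_sumr ler_piMr//.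
have := IHk j (map (orbit_map i j) s); rewrite big_map; apply.
rewrite pairwise_map; apply: sub_pairwise sep => y z /=.
by rewrite orbit_mapB normrM (gtr0_norm beta_gt0) mulrA -exprSr.
Qed.

Lemma sum_mass_le1 i s : uniq s -> \sum_(y <- s) mass i y <= 1.
Proof.
move=> /uniq_separated[e e0 sep].
have [k kP] := geometric_small beta_gt1 (C + C) e0.
apply: le_trans (@sum_mass_approx_le1 k i s _).
  by apply: ler_sum => y _; exact: mass_le_approx.
apply: sub_pairwise sep => y z e_le; apply: (@lt_le_trans _ _ (beta ^+ k * e)).
  by rewrite mulrC -ltr_pdivrMr ?exprn_gt0.
by rewrite ler_wpM2l// exprn_ge0// ltW.
Qed.

Lemma finite_heavy (c : R) i : 0 < c -> finite_set [set y | c <= mass i y].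
Proof.
move=> c0; apply: contrapT.
(* More than [c^-1] points of mass at least [c] would have total mass above 1. *)
move=> /(infinite_set_fset (Num.truncn c^-1).+1)[F F_heavy F_large].
have := sum_mass_le1 i (finmap.fset_uniq F); apply/negP; rewrite -ltNge.
apply: (@lt_le_trans _ _ (\sum_(y <- finmap.enum_fset F) c)).
  rewrite big_const_seq count_predT iter_addr_0 -mulr_natr -ltr_pdivrMl// mulr1.
  by apply: lt_le_trans (truncnS_gt _) _; rewrite ler_nat.
by rewrite big_seq [leRHS]big_seq; apply: ler_sum => y yF; exact: F_heavy.
Qed.

(** Only finitely many pairs have mass at least [c], so a maximum over these exists; being at least
    [c], it also dominates all other pairs. *)
Lemma exists_max_mass i0 y0 : 0 < mass i0 y0 ->
  exists i y, 0 < mass i y /\ forall j z, mass j z <= mass i y.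
Proof.
set c := mass i0 y0 => c0.
have : finite_set (\bigcup_i [set (i, y) | y in [set y | c <= mass i y]]).
  apply: bigcup_finite => [|i _]; first exact: finite_finset.
  exact/finite_image/finite_heavy.
move=> /finite_seqP[s sE].
have sP j z : ((j, z) \in s) = (c <= mass j z).
  apply/idP/idP => [js|jz]; last first.
    have : [set` s] (j, z) by rewrite -sE; exists j => //; exists z.
    by [].
  have : [set` s] (j, z) by [].
  by rewrite -sE => -[i _ [y cy [<- <-]]].
have [|[i y]] := @seq_argmax _ _ _ (fun t => mass t.1 t.2) s.
  by apply/eqP => s0; have := sP i0 y0; rewrite s0 lexx.
rewrite sP => ciy imax; exists i, y; split; first exact: lt_le_trans ciy.
move=> j z; have [jz|/ltW jz] := leP c (mass j z); last exact: le_trans ciy.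
by apply: (imax (j, z)); rewrite sP.
Qed.

(** The maximum is an average of values not exceeding it, so every value of positive weight equals
    it. *)
Lemma max_mass_edge i j y : E i j -> (forall l z, mass l z <= mass i y) ->
  mass j (orbit_map i j y) = mass i y.
Proof.
move=> Eij ymax; apply/eqP; rewrite -subr_eq0 -oppr_eq0 opprB.
have nneg l : true -> 0 <= p i l * (mass i y - mass l (orbit_map i l y)).
  by move=> _; rewrite mulr_ge0// subr_ge0.
have sum0 : \sum_l p i l * (mass i y - mass l (orbit_map i l y)) = 0.
  under eq_bigr do rewrite mulrBr.
  by rewrite sumrB -mulr_suml p_sum1 mul1r -mass_expand subrr.
have /eqP := psumr_eq0P nneg sum0 (isT : xpredT j).
by rewrite mulf_eq0 (gt_eqF (p_gt0 Eij)).
Qed.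

(* The expansions of y and z along a common path stay bounded, whereas each
   step multiplies their distance by beta. *)
Lemma max_mass_is_subset1 i y : 0 < mass i y ->
  (forall l z, mass l z <= mass i y) -> is_subset1 (Phifrom E lab beta i).
Proof.
move=> y0 ymax; suff eq_y z : Phifrom E lab beta i z -> z = y.
  by move=> z w /eq_y -> /eq_y ->.
move=> Phi_z; apply/esym/eqP; rewrite -subr_eq0 -normr_le0 leNgt; apply/negP.
move=> /(geometric_small beta_gt1 (C + C))[k]; apply/negP; rewrite -leNgt.
elim: k i y z y0 ymax Phi_z => [|k IHk] i y z y0 ymax Phi_z.
  rewrite expr0 invr1 mulr1 (le_trans (ler_normB _ _))// lerD//.
    exact: mass_bound y0.
  exact: Phifrom_bound Phi_z.
have [j Eij Phi_j] := Phifrom_expand beta_gt1 lab_bounded Phi_z.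
have eq_m := max_mass_edge Eij ymax.
have := IHk j (orbit_map i j y) (orbit_map i j z); rewrite eq_m.
move=> /(_ y0 ymax Phi_j); rewrite orbit_mapB normrM (gtr0_norm beta_gt0).
rewrite -ler_pdivlMl// => /le_trans; apply.
by rewrite exprS invfM mulrCA.
Qed.

Lemma mass_is_subset1 i y : 0 < mass i y ->
  exists j, is_subset1 (Phifrom E lab beta j).
Proof.
move=> /exists_max_mass[j [z [z0 zmax]]].
by exists j; exact: max_mass_is_subset1 z0 zmax.
Qed.

End AtomMass.

(** * Countable null unions and cylinder sets *)

Lemma countable_null_bigcup d (X : measurableType d) (R : realType)
    (mu : {measure set X -> \bar R}) (T : Type) (D : set T) (F : T -> set X) :
  countable D -> (forall t, D t -> measurable (F t)) ->
  (forall t, D t -> mu (F t) = 0%E) -> mu.-negligible (\bigcup_(t in D) F t).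
Proof.
move=> /countable_injP[f f_inj] mF F0.
(* Reindexing by [nat] through the injection [f] leaves at most one [t] for each [k]. *)
apply: (@negligibleS _ _ _ _
  (\bigcup_k \bigcup_(t in [set t | D t /\ f t = k]) F t)).
  by move=> x [t Dt Ftx]; exists (f t) => //; exists t.
apply: negligible_bigcup => k.
have [[t [Dt ftk]]|none] := pselect (exists t, D t /\ f t = k).
  exists (F t); split; [exact: mF|exact: F0|move=> x [u [Du fuk] Fux]].
  by rewrite (f_inj t u) ?inE// ftk fuk.
rewrite (_ : \bigcup_(t in _) _ = set0); first exact: negligible_set0.
by rewrite -subset0 => x [t tP _]; apply: none; exists t.
Qed.

Lemma mkseq_tail (x : nat -> int) k :
  mkseq x k.+1 = x 0%N :: mkseq (seq_tail x) k.
Proof. by rewrite /mkseq /= -(addn0 1%N) iotaDl -map_comp. Qed.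

Lemma cylE s x : cyl s x <-> mkseq x (size s) = s.
Proof.
split=> [xs|<- k]; last by rewrite size_mkseq => k_lt; rewrite nth_mkseq.
apply: (@eq_from_nth _ 0); rewrite size_mkseq// => k k_lt.
by rewrite nth_mkseq// xs.
Qed.

Lemma cyl_mkseq x k : cyl (mkseq x k) x.
Proof. by apply/cylE; rewrite size_mkseq. Qed.

Lemma measurable_cyl s : measurable (cyl s : set seqspace).
Proof. by apply: sub_sigma_algebra; exists s. Qed.

Lemma measurable_bigcup_cyl (W : set (seq int)) :
  measurable (\bigcup_(s in W) cyl s : set seqspace).
Proof.
rewrite bigcup_mkcond; apply: countable_bigcupT_measurable => [|s].
  exact: countableP.
by case: ifP => // _; exact: measurable_cyl.
Qed.

Fixpoint words (A : seq int) (k : nat) : seq (seq int) :=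
  if k is k'.+1 then [seq a :: s | a <- A, s <- words A k'] else [:: [::]].

Lemma mem_words A k x : (forall j, x j \in A) -> mkseq x k \in words A k.
Proof.
elim: k x => [|k IHk] x xA; first by rewrite inE.
by rewrite mkseq_tail; apply: allpairs_f => //; apply: IHk => j; exact: xA.
Qed.

Lemma size_words A k s : s \in words A k -> size s = k.
Proof.
elim: k s => [|k IHk] s /=; first by rewrite inE => /eqP ->.
by move=> /allpairsP[[a t] /= [_ /IHk <- ->]].
Qed.

Lemma measure_cyl_cover (R : realType) (mu : probability seqspace R)
    (l : seq (seq int)) (P : pred (seq int)) (X : set seqspace) :
  measurable X -> X `<=` \big[setU/set0]_(s <- l | P s) cyl s ->
  (mu X <= \sum_(s <- l | P s) mu (cyl s))%E.
Proof.
move=> mX /(le_measure mu) leX; apply: le_trans (leX _ _) _; rewrite ?inE//.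
  by apply: bigsetU_measurable => s _; exact: measurable_cyl.
elim: l {X mX leX} => [|s l IHl]; first by rewrite !big_nil measure0.
rewrite !big_cons; case: ifP => // _.
apply: le_trans (measureU2 _ (measurable_cyl s) _) _.
  by apply: bigsetU_measurable => t _; exact: measurable_cyl.
by rewrite leeD2l.
Qed.

(** * The measure [mu] as a Markov measure, and the dichotomy *)

Section ParryMeasure.
Variables (R : realType) (A : seq int) (n : nat) (E : rel 'I_n).
Variables (lab : 'I_n -> 'I_n -> int) (beta lambda : R) (vL vR : 'cV[R]_n).
Variable mu : probability seqspace R.
Hypothesis A_uniq : uniq A.
Hypothesis lab_A : forall i j, E i j -> lab i j \in A.
Hypothesis lambda_gt0 : 0 < lambda.
Hypothesis vR_eigen : Mtot R E lab A *m vR = lambda *: vR.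
Hypothesis vR_gt0 : forall i, 0 < vR i 0.
Hypothesis beta_gt1 : 1 < beta.
Hypothesis mu_cyl : forall s : seq int, mu (cyl s) =
  (lambda ^- size s * (vL^T *m word_mx R E lab s *m vR) 0 0)%:E.

Let B : R := \sum_(a <- A) `|a%:~R|.
Let C := expansion_radius beta B.

Let lab_bounded i j : E i j -> `|(lab i j)%:~R| <= B.
Proof.
move=> /lab_A labA; rewrite /B (bigD1_seq (lab i j))//= lerDl.
by apply: sumr_ge0 => a _; exact: normr_ge0.
Qed.

(** An edge has one label and [A] lists it once; this turns sums over digits into sums over
    edges. *)
Lemma sum_Mlab i j (f : int -> R) :
  \sum_(a <- A) Mlab R E lab a i j * f a = if E i j then f (lab i j) else 0.
Proof.
have [Eij|nEij] := boolP (E i j); last first.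
  by rewrite big1// => a _; rewrite mxE (negbTE nEij) mul0r.
rewrite (bigD1_seq (lab i j))//= ?lab_A// mxE Eij eqxx mul1r big1 ?addr0// => a.
by rewrite mxE Eij eq_sym => /negbTE ->; rewrite mul0r.
Qed.

Lemma MtotE i j : Mtot R E lab A i j = (E i j)%:R.
Proof.
rewrite /Mtot summxE; have := sum_Mlab i j (fun=> 1).
under eq_bigr do rewrite mulr1.
by move=> ->; case: (E i j).
Qed.

Lemma primitive_is_subset1 : primitive_mx (Mtot R E lab A) ->
  (exists i, is_subset1 (Phifrom E lab beta i)) ->
  forall j, is_subset1 (Phifrom E lab beta j).
Proof.
(* The nonzero entry (i, j) of the power supplies a path from [i] to [j], along which the property
   travels edge by edge. *)
move=> [_ [k M_gt0]] [i sub_i] j; have {M_gt0} := lt0r_neq0 (M_gt0 i j).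
elim: k i sub_i => [|k IHk] i sub_i.
  rewrite expr0 mxE; have [<- _//|_] := eqVneq i j.
  by rewrite eqxx.
rewrite exprS mxE => sum_neq0.
have [l] : exists l, Mtot R E lab A i l * (Mtot R E lab A ^+ k) l j != 0.
  apply: contrapT => /forallNP all0; move/eqP: sum_neq0; apply.
  by apply: big1 => l _; apply/eqP/negP => /negP; exact: all0.
rewrite mulf_eq0 negb_or MtotE => /andP[Eil]; apply: IHk.
apply: (is_subset1_Phifrom_edge beta_gt1 lab_bounded _ sub_i).
by apply: contraNT Eil => /negbTE ->.
Qed.

(** Parry's chain: the adjacency matrix conjugated by the right Perron vector, with rows summing to
    1 by the eigenvector equation. *)
Let p i j : R := if E i j then vR j 0 / (lambda * vR i 0) else 0.

Let p_gt0 i j : E i j -> 0 < p i j.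
Proof. by rewrite /p => ->; rewrite divr_gt0// mulr_gt0. Qed.

Let p_eq0 i j : ~~ E i j -> p i j = 0.
Proof. by rewrite /p => /negbTE ->. Qed.

Let p_sum1 i : \sum_j p i j = 1.
Proof.
have /(congr1 (fun v : 'cV[R]_n => v i 0)) := vR_eigen; rewrite !mxE => eigen.
have den0 : lambda * vR i 0 != 0 by rewrite mulf_neq0 ?gt_eqF.
apply: (mulIf den0); rewrite mul1r -[RHS]eigen mulr_suml; apply: eq_bigr => j _.
by rewrite MtotE /p; case: (E i j); rewrite ?mul0r// divfK// mul1r.
Qed.

(** Divided by [lambda ^+ size s * vR i 0], this is the probability that the chain [p] started at
    [i] reads [s]. *)
Definition weight (s : seq int) (i : 'I_n) : R := (word_mx R E lab s *m vR) i 0.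

Lemma weight_nil i : weight [::] i = vR i 0.
Proof. by rewrite /weight mul1mx. Qed.

Lemma weight_cons a s i :
  weight (a :: s) i = \sum_j Mlab R E lab a i j * weight s j.
Proof. by rewrite /weight /= -mulmxA mxE. Qed.

Lemma weight_ge0 s i : 0 <= weight s i.
Proof.
elim: s i => [|a s IHs] i; first by rewrite weight_nil ltW.
rewrite weight_cons; apply: sumr_ge0 => j _; rewrite mulr_ge0// mxE.
by case: ifP.
Qed.

Lemma mu_cylE s :
  mu (cyl s) = (lambda ^- size s * \sum_i vL i 0 * weight s i)%:E.
Proof.
rewrite mu_cyl -mulmxA mxE; congr (_ * _)%:E.
by apply: eq_bigr => i _; rewrite mxE.
Qed.

Lemma weight_gt0 k i x : Kfrom E lab i x -> 0 < weight (mkseq x k) i.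
Proof.
elim: k i x => [|k IHk] i x Kx; first by rewrite weight_nil.
have [j [Eij x0 Kj]] := Kfrom_tail Kx.
rewrite mkseq_tail weight_cons (bigD1 j)//= ltr_pwDl//.
  by rewrite mxE Eij x0 eqxx mul1r IHk.
apply: sumr_ge0 => l _; rewrite mulr_ge0 ?weight_ge0// mxE.
by case: ifP.
Qed.

(** A state is a vertex together with the digits still to be read; the constraints all sit in
    [edge]. *)
Let step (t : 'I_n * (nat -> int)) (j : 'I_n) := (j, seq_tail t.2).
Let edge (t : 'I_n * (nat -> int)) (j : 'I_n) : Prop :=
  E t.1 j /\ lab t.1 j = t.2 0%N.
Let ok (t : 'I_n * (nat -> int)) : Prop := True.

Lemma weight_survives k i x :
  weight (mkseq x k) i != 0 -> survives step edge ok k (i, x).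
Proof.
elim: k i x => [|k IHk] i x //; rewrite mkseq_tail weight_cons => sum_neq0.
split=> //; have [j] : exists j,
    Mlab R E lab (x 0%N) i j * weight (mkseq (seq_tail x) k) j != 0.
  apply: contrapT => /forallNP all0; move/eqP: sum_neq0; apply.
  by apply: big1 => j _; apply/eqP/negP => /negP; exact: all0.
rewrite mulf_eq0 negb_or mxE => /andP[+ /IHk surv].
case: ifPn => [/andP[Eij /eqP labx] _|]; last by rewrite eqxx.
by exists j.
Qed.

(** By Koenig's lemma, a sequence whose prefixes can all be read in the graph lies in [Kplus]. The
    complement is thus a countable union of null cylinders, which gives both measurability and full
    measure of [Kplus]. *)
Lemma setC_Kplus : ~` Kplus E lab =
  \bigcup_(s in [set s | forall i, weight s i = 0]) cyl s.
Proof.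
apply/seteqP; split=> x; last first.
  move=> [s s0 /cylE sE]; rewrite KplusE => -[i _ /(weight_gt0 (size s))].
  by rewrite sE s0 ltxx.
move=> nKx; apply: contrapT => prefix; apply: nKx.
(* The starting vertex could vary with the length of the prefix; the pigeonhole fixes one for all
   lengths. *)
have [||i surv] := @pigeonhole_antitone 'I_n
    (fun k i => survives step edge ok k (i, x)).
- by move=> k l i; exact: survives_le.
- move=> k; apply: contrapT => /forallNP dead; apply: prefix.
  exists (mkseq x k); last exact: cyl_mkseq.
  by move=> i; apply/eqP/negP => /negP /weight_survives; exact: dead.
have [s [c [s0 sS sE _]]] := koenig surv.
have s2 k l : (s k).2 l = x (k + l)%N.
  elim: k l => [|k IHk] l; first by rewrite s0.
  by rewrite sS /= /seq_tail IHk addnS.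
exists (fun k => (s k).1) => k; have [Ek labk] := sE k.
by rewrite [in (s k.+1).1]sS /=; split=> //; rewrite labk s2 addn0.
Qed.

Lemma measurable_Kplus : measurable (Kplus E lab : set seqspace).
Proof.
rewrite -[Kplus E lab]setCK setC_Kplus; apply: measurableC.
exact: measurable_bigcup_cyl.
Qed.

Lemma mu_setC_Kplus : mu (~` Kplus E lab) = 0%E.
Proof.
apply/negligibleP; first by apply: measurableC; exact: measurable_Kplus.
rewrite setC_Kplus; apply: countable_null_bigcup => [|s _|s s0].
- exact: countableP.
- exact: measurable_cyl.
apply: etrans (mu_cylE s) _.
by rewrite big1 ?mulr0// => i _; rewrite s0 mulr0.
Qed.

Lemma mu_Kplus : mu (Kplus E lab) = 1%E.
Proof.
rewrite -[Kplus E lab]setCK probability_setC.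
  by rewrite mu_setC_Kplus sube0.
by apply: measurableC; exact: measurable_Kplus.
Qed.

Definition read_word (s : seq int) (y : R) : R :=
  foldl (fun y a => beta * y - a%:~R) y s.

Lemma read_word_phiplus k i x : Kfrom E lab i x ->
  `|read_word (mkseq x k) (phiplus beta x)| <= C.
Proof.
elim: k i x => [|k IHk] i x Kx.
  exact: phiplus_bound (Kfrom_bounded lab_bounded Kx).
have [j [_ _ Kj]] := Kfrom_tail Kx; rewrite mkseq_tail /=.
rewrite -(phiplus_tail beta_gt1 (Kfrom_bounded lab_bounded Kx)).
exact: IHk Kj.
Qed.

Definition fiber (y : R) : set seqspace :=
  Kplus E lab `&` phiplus beta @^-1` [set y].

(** A sequence of [Kplus] has value [y] iff none of its prefixes drives [y] out of [-C, C]. Only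
    countably many cylinders occur, so the fiber is measurable. *)
Lemma fiberE y :
  fiber y =
  Kplus E lab `\` \bigcup_(s in [set s | ~~ (`|read_word s y| <= C)]) cyl s.
Proof.
apply/seteqP; split=> x [Kx].
  move=> xy; split=> // -[s /= s_far /cylE sE]; move/negP: s_far; apply.
  move: Kx; rewrite KplusE => -[i _ Kx].
  by rewrite -sE -xy; exact: read_word_phiplus Kx.
move=> near_x; split=> //=; move: Kx; rewrite KplusE => -[i _ Kx].
apply/esym.
apply: (@expansion_unique _ _ B beta_gt1 (fun k => read_word (mkseq x k) y)).
- exact: Kfrom_bounded Kx.
- by move=> k; rewrite mkseqS /read_word foldl_rcons.
- move=> k; apply: contrapT => /negP far; apply: near_x.
  by exists (mkseq x k) => //; exact: cyl_mkseq.
Qed.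

Lemma measurable_fiber y : measurable (fiber y).
Proof.
rewrite fiberE; apply: measurableD; first exact: measurable_Kplus.
exact: measurable_bigcup_cyl.
Qed.

Local Notation mass_approx := (mass_approx lab beta B p).
Local Notation mass := (mass lab beta B p).

(** This links cylinder measures to the chain: when the first letter is split off, [vR j 0 / lambda]
    becomes [vR i 0 * p i j]. *)
Lemma sum_weight k i y :
  \sum_(s <- words A k | `|read_word s y| <= C) lambda ^- k * weight s i =
  vR i 0 * mass_approx k i y.
Proof.
rewrite big_mkcond; elim: k i y => [|k IHk] i y.
  rewrite big_seq1 weight_nil expr0 invr1 mul1r /=.
  by case: ifP => _; rewrite ?mulr1 ?mulr0.
rewrite /= big_allpairs_dep /=.
transitivity (\sum_(a <- A) \sum_j lambda^-1 *
    (Mlab R E lab a i j * (vR j 0 * mass_approx k j (beta * y - a%:~R)))).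
  apply: eq_bigr => a _; under [RHS]eq_bigr do rewrite -IHk !mulr_sumr.
  rewrite exchange_big; apply: eq_bigr => s _.
  case: ifP => _; last by rewrite big1// => j _; rewrite !mulr0.
  rewrite weight_cons mulr_sumr; apply: eq_bigr => j _.
  by rewrite exprS invfM -mulrA; congr (_ * _); rewrite mulrCA.
rewrite exchange_big mulr_sumr; apply: eq_bigr => j _.
rewrite -mulr_sumr.
rewrite (sum_Mlab i j (fun a => vR j 0 * mass_approx k j (beta * y - a%:~R))).
rewrite /p; case: (E i j); last by rewrite !mul0r !mulr0.
rewrite /orbit_map; field.
by rewrite !gt_eqF.
Qed.

(** The fiber is covered by the cylinders of the words of length [k] that keep [y] in [-C, C]. *)
Lemma mu_fiber_le k y :
  (mu (fiber y) <= (\sum_i vL i 0 * (vR i 0 * mass_approx k i y))%:E)%E.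
Proof.
apply: le_trans (@measure_cyl_cover _ mu (words A k)
  (fun s => `|read_word s y| <= C) _ (measurable_fiber y) _) _.
  move=> x [Kx xy]; rewrite -bigcup_seq_cond.
  exists (mkseq x k); last exact: cyl_mkseq.
  rewrite /= mem_words /=.
    move: Kx; rewrite KplusE => -[i _ Kx].
    by rewrite -xy; exact: read_word_phiplus Kx.
  by move=> j; have [v vP] := Kx; have [Ej ->] := vP j; exact: lab_A.
have -> : \sum_i vL i 0 * (vR i 0 * mass_approx k i y) =
    \sum_(s <- words A k | `|read_word s y| <= C)
      \sum_i vL i 0 * (lambda ^- k * weight s i).
  rewrite exchange_big; apply: eq_bigr => i _.
  by rewrite -sum_weight mulr_sumr.
rewrite -sumEFin big_seq_cond [leRHS]big_seq_cond.
apply: lee_sum => s /andP[/size_words size_s _].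
rewrite mu_cylE size_s lee_fin mulr_sumr.
by apply: ler_sum => i _; rewrite mulrCA.
Qed.

Lemma no_mass_fiber y : (forall i, mass i y = 0) -> mu (fiber y) = 0%E.
Proof.
move=> mass0; apply/eqP; rewrite eq_le; apply/andP; split;
  last exact: measure_ge0.
have fin_mu : mu (fiber y) \is a fin_num.
  by apply: fin_num_measure; exact: measurable_fiber.
rewrite -(fineK fin_mu) lee_fin.
have lim0 : \sum_i vL i 0 * (vR i 0 * mass_approx k i y) @[k --> \oo] -->
    (\sum_i vL i 0 * (vR i 0 * 0) : R).
  apply: cvg_big => [|i _]; first exact: add_continuous.
  do 2!apply: cvgMr; rewrite -(mass0 i).
  exact: (@cvg_mass _ _ E).
move: lim0; rewrite big1 => [lim0|i _]; last by rewrite !mulr0.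
rewrite -(cvg_lim _ lim0)//; apply: limr_ge; first exact: cvgP lim0.
by apply: nearW => k; rewrite -lee_fin fineK// mu_fiber_le.
Qed.

Lemma Phi_dichotomy : primitive_mx (Mtot R E lab A) ->
  let Phi := phiplus beta @` Kplus E lab in
  let nu := pushmu E lab beta mu in
  (finite_set Phi /\ purely_atomic nu) \/
  [/\ perfect_set Phi, ~ countable Phi & no_atoms nu].
Proof.
move=> primM Phi nu.
have PhiE : Phi = \bigcup_i Phifrom E lab beta i.
  by rewrite /Phi KplusE image_bigcup.
(* In the first case primitivity spreads the property to all vertices; in the second neither an atom
   nor an isolated point can exist, since each would produce such a vertex. *)
have [degenerate|generic] :=
  pselect (exists i, is_subset1 (Phifrom E lab beta i)).
  have finPhi : finite_set Phi.
    by rewrite PhiE; apply: finite_Phi; exact: primitive_is_subset1.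
  left; split=> //; exists Phi; split; first exact: finite_set_countable.
  by rewrite /nu /pushmu setIidl ?mu_Kplus//; exact: preimage_image.
right.
have atomless : no_atoms nu.
  move=> y; apply: no_mass_fiber => i; apply/eqP.
  have := @mass_ge0 _ _ E lab beta B p beta_gt1 lab_bounded p_gt0 p_eq0
    p_sum1 i y.
  rewrite le_eqVlt eq_sym => /orP[//|mass_gt0]; exfalso; apply: generic.
  exact: (mass_is_subset1 beta_gt1 lab_bounded p_gt0 p_eq0 p_sum1 mass_gt0).
split=> //.
  have closedPhi : closed Phi.
    rewrite PhiE; apply: closed_bigcup => [|i _]; first exact: finite_finset.
    exact: closed_Phifrom beta_gt1 lab_bounded i.
  split=> //; apply/seteqP; split=> [y lim_y|y Phi_y].
    exact/closedPhi/subset_limit_point.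
  have [i _ Phi_i] : (\bigcup_i Phifrom E lab beta i) y by rewrite -PhiE.
  apply: contrapT => isolated; apply: generic.
  apply: (isolated_is_subset1 beta_gt1 lab_bounded _ Phi_i isolated).
  by rewrite PhiE; exact: bigcup_sup.
(* Uncountability comes from the measure: a countable [Phi] would cover [Kplus] by countably many
   null fibers, against its mass 1. *)
move=> countPhi; suff : mu (Kplus E lab) = 0%E.
  by rewrite mu_Kplus => /eqP; rewrite onee_eq0.
apply/negligibleP; first exact: measurable_Kplus.
apply: (@negligibleS _ _ _ _ (\bigcup_(y in Phi) fiber y)).
  by move=> x Kx; exists (phiplus beta x) => //; exists x.
apply: countable_null_bigcup => // y _; first exact: measurable_fiber.
exact: atomless.
Qed.

End ParryMeasure.

Theorem theorem6 (R : realType) (A : seq int) (n : nat) (E : rel 'I_n)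
    (lab : 'I_n -> 'I_n -> int) (beta lambda : R) (vL vR : 'cV[R]_n)
    (mu : probability seqspace R) :
  uniq A ->
  (forall i j, E i j -> lab i j \in A) ->
  primitive_mx (Mtot R E lab A) ->
  perron_data (Mtot R E lab A) lambda vL vR ->
  pisot beta ->
  (forall s : seq int,
     mu (cyl s) =
       (lambda ^- size s * (vL^T *m word_mx R E lab s *m vR) 0 0)%:E) ->
  let Phi := phiplus beta @` Kplus E lab in
  let nu := pushmu E lab beta mu in
  (finite_set Phi /\ purely_atomic nu) \/
  ([/\ perfect_set Phi, ~ countable Phi & no_atoms nu]).
Proof.
move=> A_uniq lab_A primM [lambda_gt0 _ [_ vR_eigen] [_ vR_gt0] _] [beta_gt1 _].
move=> mu_cyl.
exact: (Phi_dichotomy A_uniq lab_A lambda_gt0 vR_eigen vR_gt0 beta_gt1 mu_cyl).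
Qed.
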